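(* Let $G$ be a graph with chromatic number $k$. Then for every $t \in \{0, \dots, k\}$ and every signature $\sigma$ of $G$: $\chi_{sym}^t(G,\sigma) \leq 2k-t$. Furthermore, $\chi_{sym}^t(\pm G) = 2k-t$, and there are simple signed graphs $(H,\sigma_H)$ (i.e. with $H$ a simple graph) such that $\chi(H)=k$ and $\chi_{sym}^t(H,\sigma_H)=2k-t$.
   Context: Graphs are finite multigraphs without loops (parallel edges allowed unless called simple). A signed graph $(G,\sigma)$ is a graph $G$ with a signature $\sigma:E(G)\to\{+,-\}$. The signed extension $\pm G$ of a graph $G$ is the signed graph obtained from $G$ by replacing every edge by two parallel edges, one positive and one negative. A symmetric set is a set $S$ with an involution $s\mapsto -s$ on $S$; $s$ is self-inverse if $s=-s$. $S_{2k}^t$ ($t,k\ge 0$) is the symmetric set with exactly $t$ self-inverse elements $0_1,\dots,0_t$ and $2k$ non-self-inverse elements $\pm s_1,\dots,\pm s_k$. A proper $S_{2k}^t$-coloring of $(G,\sigma)$ is a map $c:V(G)\to S_{2k}^t$ with $c(v)\ne\sigma(e)c(w)$ for every edge $e=vw$. For $t\in\{0,\dots,\chi(G)\}$, the symset $t$-chromatic number $\chi_{sym}^t(G,\sigma)$ is the minimum of $t+2j$ over all $j\ge0$ for which $(G,\sigma)$ has a proper $S_{2j}^t$-coloring. *)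

(* Defs.v *)
From mathcomp Require Import all_boot.

Set Implicit Arguments.
Unset Strict Implicit.
Unset Printing Implicit Defensive.

(* Finite loopless multigraphs: every edge has a set of exactly two ends, and
   several edges may have the same ends. *)
Record mgraph := MGraph {
  vertex : finType;
  edge : finType;
  ends : edge -> {set vertex};
  card_ends : forall e, #|ends e| = 2
}.

Definition simple (G : mgraph) : Prop := injective (@ends G).

(* A sign is a boolean, [true] being the negative sign (as in (-1)^b). *)
Definition signature (G : mgraph) := edge G -> bool.

Record signed_graph := SignedGraph {
  underlying :> mgraph;
  sign : signature underlying
}.

Section SignedExtension.
Variable G : mgraph.

Definition ext_ends (e : edge G * bool) : {set vertex G} := ends e.1.

Lemma card_ext_ends e : #|ext_ends e| = 2.
Proof. exact: card_ends. Qed.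

Definition signed_extension : signed_graph :=
  @SignedGraph (MGraph card_ext_ends) (fun e : edge G * bool => e.2).

End SignedExtension.

Definition proper_coloring (G : mgraph) (C : finType)
    (c : {ffun vertex G -> C}) : bool :=
  [forall e : edge G, forall v, forall w,
     (ends e == [set v; w]) ==> (c v != c w)].

Definition colorable (G : mgraph) (k : nat) : bool :=
  [exists c : {ffun vertex G -> 'I_k}, proper_coloring c].

Lemma ends_neq (G : mgraph) (e : edge G) v w : ends e = [set v; w] -> v != w.
Proof. by move=> E; have := card_ends e; rewrite E cards2; case: eqP. Qed.

Lemma ex_colorable (G : mgraph) : exists k, colorable G k.
Proof.
exists #|vertex G|; apply/existsP; exists [ffun v => enum_rank v].
apply/'forall_'forall_forallP=> e v w; apply/implyP=> /eqP E.
by rewrite !ffunE (inj_eq enum_rank_inj) (ends_neq E).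
Qed.

Definition chromatic_number (G : mgraph) : nat := ex_minn (ex_colorable G).

Record symset := SymSet {
  sym_carrier :> finType;
  sopp : sym_carrier -> sym_carrier;
  soppK : involutive sopp
}.

Definition self_inverse (S : symset) (x : S) : bool := sopp x == x.

Definition sign_act (S : symset) (b : bool) (x : S) : S :=
  if b then sopp x else x.

(* [std_symset t k] is $S_{2k}^t$: [inl i] is the self-inverse element 0_(i+1),
   [inr (i, false)] is s_(i+1) and [inr (i, true)] is -s_(i+1). *)
Definition std_opp (t k : nat) (x : 'I_t + 'I_k * bool) : 'I_t + 'I_k * bool :=
  match x with inl i => inl i | inr (i, b) => inr (i, ~~ b) end.

Lemma std_oppK t k : involutive (@std_opp t k).
Proof. by case=> [i|[i b]] //=; rewrite negbK. Qed.

Definition std_symset (t k : nat) : symset := SymSet (@std_oppK t k).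

Lemma card_std_symset t k : #|std_symset t k| = t + 2 * k.
Proof. by rewrite card_sum card_prod !card_ord card_bool mulnC. Qed.

Lemma card_self_inverse t k :
  #|[set x : std_symset t k | self_inverse x]| = t.
Proof.
have -> : [set x : std_symset t k | self_inverse x] = inl @: [set: 'I_t].
  apply/setP=> -[i|[i b]]; rewrite inE /self_inverse /=.
    by rewrite eqxx imset_f.
  by apply/eqP/imsetP => [[]|[]] //; case: b.
by rewrite card_imset ?cardsT ?card_ord // => i j [].
Qed.

Definition proper_sym_coloring (G : signed_graph) (S : symset)
    (c : {ffun vertex G -> S}) : bool :=
  [forall e : edge G, forall v, forall w,
     (ends e == [set v; w]) ==> (c v != sign_act (sign e) (c w))].

Definition sym_colorable (G : signed_graph) (t j : nat) : bool :=
  [exists c : {ffun vertex G -> std_symset t j}, proper_sym_coloring c].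

Lemma ex_sym_colorable (t : nat) (G : signed_graph) :
  exists j, sym_colorable G t j.
Proof.
exists #|vertex G|; apply/existsP.
exists [ffun v => inr (enum_rank v, false) : std_symset t #|vertex G|].
apply/'forall_'forall_forallP=> e v w; apply/implyP=> /eqP E; rewrite !ffunE.
have := ends_neq E; apply: contra => /eqP.
by rewrite /sign_act; case: (sign e) => -[] // /enum_rank_inj ->.
Qed.

Definition chi_sym (t : nat) (G : signed_graph) : nat :=
  t + 2 * ex_minn (ex_sym_colorable t G).

(* Main.v *)
Require Import Defs.
From mathcomp Require Import all_boot.
From mathcomp Require Import zify.

Set Implicit Arguments.
Unset Strict Implicit.
Unset Printing Implicit Defensive.

(* Identifying s with -s turns the 2j + t colors of S_{2j}^t into j + t absolute
   values.  Giving the k color classes of G distinct absolute values yields a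
   proper S_{2(k-t)}^t-coloring for every signature; conversely, the absolute
   values of a proper coloring of +-G properly color G, so j + t >= k.

   For simple graphs, start from the empty graph and repeatedly add a new
   independent part, containing for every set U of old vertices M twins that
   are joined negatively to U and positively to the other old vertices.  Suppose
   that the old vertices carry k absolute values, each realised by two vertices
   of equal color, one in U and one outside U.  Then a twin associated with U
   cannot use any of these values, and if M exceeds the number of colors then
   two such twins have equal color: they realise a (k+1)-st absolute value.
   So k parts force j + t >= k as in +-G, although the graph is k-partite. *)

Lemma proper_coloringP (G : mgraph) (C : finType) (c : {ffun vertex G -> C}) :
  reflect (forall e v w, ends e = [set v; w] -> c v != c w)
          (proper_coloring c).
Proof.
apply: (iffP 'forall_'forall_forallP) => c_proper e v w.
  by move=> /eqP E; have /implyP := c_proper e v w; apply.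
by apply/implyP=> /eqP /c_proper.
Qed.

Lemma proper_sym_coloringP (G : signed_graph) (S : symset)
    (c : {ffun vertex G -> S}) :
  reflect (forall (e : edge G) v w,
             ends e = [set v; w] -> c v != sign_act (sign e) (c w))
          (proper_sym_coloring c).
Proof.
apply: (iffP 'forall_'forall_forallP) => c_proper e v w.
  by move=> /eqP E; have /implyP := c_proper e v w; apply.
by apply/implyP=> /eqP /c_proper.
Qed.

Lemma proper_colorable (G : mgraph) (C : finType) (c : {ffun vertex G -> C}) :
  proper_coloring c -> colorable G #|C|.
Proof.
move=> /proper_coloringP c_proper; apply/existsP.
exists [ffun v => enum_rank (c v)]; apply/proper_coloringP=> e v w E.
by rewrite !ffunE (inj_eq enum_rank_inj) (c_proper e).
Qed.

Lemma chromatic_number_colorable (G : mgraph) : colorable G (chromatic_number G).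
Proof. by rewrite /chromatic_number; case: ex_minnP. Qed.

Lemma chromatic_number_le (G : mgraph) n :
  colorable G n -> chromatic_number G <= n.
Proof. by rewrite /chromatic_number; case: ex_minnP => m _; apply. Qed.

Lemma chi_sym_le t (G : signed_graph) j :
  sym_colorable G t j -> chi_sym t G <= t + 2 * j.
Proof.
by rewrite /chi_sym leq_add2l leq_pmul2l //; case: ex_minnP => m _; apply.
Qed.

Lemma chi_sym_ge t (G : signed_graph) n :
  (forall j, sym_colorable G t j -> n <= t + 2 * j) -> n <= chi_sym t G.
Proof. by rewrite /chi_sym => n_le; case: ex_minnP => m /n_le. Qed.

Definition abs_color t j (x : std_symset t j) : 'I_t + 'I_j :=
  match x with inl i => inl i | inr (i, _) => inr i end.

Lemma abs_color_sign_act t j b (x : std_symset t j) :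
  abs_color (sign_act b x) = abs_color x.
Proof. by case: b x => -[i|[i b]]. Qed.

(** Two adjacent vertices whose colors share an absolute value violate an edge of sign [b]. *)
Lemma abs_color_eq t j (x y : std_symset t j) :
  abs_color x = abs_color y -> exists b, x = sign_act b y.
Proof.
case: x y => [i|[i a]] [i'|[i' a']] //= [->]; first by exists false.
by exists (a != a'); case: a a' => -[].
Qed.

Lemma card_abs_color t j : #|{: 'I_t + 'I_j}| = t + j.
Proof. by rewrite card_sum !card_ord. Qed.

Lemma colorable_sym_colorable (G : signed_graph) t j :
  colorable G (t + j) -> sym_colorable G t j.
Proof.
case/existsP=> c /proper_coloringP c_proper; apply/existsP.
(* A section of [abs_color]: one representative of each absolute value, positive when it is not
   self-inverse. *)
pose f (i : 'I_(t + j)) : std_symset t j :=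
  match split i with inl a => inl a | inr a => inr (a, false) end.
have abs_f i : abs_color (f i) = split i by rewrite /f; case: (split i).
exists [ffun v => f (c v)]; apply/proper_sym_coloringP=> e v w E.
rewrite !ffunE; apply: contra (c_proper e v w E) => /eqP/(congr1 (@abs_color t j)).
by rewrite abs_color_sign_act !abs_f => /(can_inj splitK) ->.
Qed.

Lemma sym_colorable_extension (G : mgraph) t j :
  sym_colorable (signed_extension G) t j -> colorable G (t + j).
Proof.
case/existsP=> c /proper_sym_coloringP c_proper; rewrite -card_abs_color.
apply: (@proper_colorable _ _ [ffun v : vertex G => abs_color (c v)]).
apply/proper_coloringP=> e v w E; rewrite !ffunE.
apply/eqP=> /abs_color_eq[b Eb].
(* Of the two copies of [e], the one of sign [b] is violated. *)
by have := c_proper (e, b) v w E; rewrite Eb eqxx.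
Qed.

Section AddPart.
Variables (M : nat) (G : signed_graph).

(** [(U, m)] is the [m]-th twin associated with [U]. *)
Definition part_vertex : finType := ({set vertex G} * 'I_M)%type.

Definition part_ends (e : edge G + vertex G * part_vertex) :
    {set vertex G + part_vertex} :=
  match e with
  | inl e => inl @: ends e
  | inr (v, p) => [set inl v; inr p]
  end.

Lemma card_part_ends e : #|part_ends e| = 2.
Proof.
case: e => [e|[v p]] /=; last by rewrite cards2.
by rewrite card_imset ?card_ends // => v w [].
Qed.

Definition add_part : signed_graph :=
  @SignedGraph (MGraph card_part_ends)
    (fun e : edge G + vertex G * part_vertex =>
       match e with inl e => sign e | inr (v, (U, _)) => v \in U end).

Lemma mem_part_ends_inl e v :
  (inl v \in part_ends e) =
  match e with inl e => v \in ends e | inr (w, _) => v == w end.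
Proof.
case: e => [e|[w p]] /=; first by rewrite mem_imset // => x y [].
by rewrite !inE orbF.
Qed.

Lemma mem_part_ends_inr e p :
  (inr p \in part_ends e) =
  match e with inl e => false | inr (_, q) => p == q end.
Proof.
case: e => [e|[w q]] /=; last by rewrite !inE.
by apply/negbTE/imsetP => -[].
Qed.

(** The old and the new vertices on an edge tell its kind. An old edge is then determined by
    simplicity of [G], a new one by its two ends. *)
Lemma simple_add_part : simple G -> simple add_part.
Proof.
move=> G_simple e1 e2 /= /setP E.
have El v := E (inl v); have Er p := E (inr p).
case: e1 e2 {E} El Er => [e1|[v1 p1]] [e2|[v2 p2]] El Er.
- congr inl; apply: G_simple; apply/setP=> v.
  by have := El v; rewrite !mem_part_ends_inl.
- by have := Er p2; rewrite !mem_part_ends_inr eqxx.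
- by have := Er p1; rewrite !mem_part_ends_inr eqxx.
have := El v1; rewrite !mem_part_ends_inl eqxx => /esym/eqP <-.
by have := Er p1; rewrite !mem_part_ends_inr eqxx => /esym/eqP <-.
Qed.

Lemma colorable_add_part n : colorable G n -> colorable add_part n.+1.
Proof.
case/existsP=> c /proper_coloringP c_proper.
(* [None] is the fresh color, shared by the whole independent part. *)
have -> : n.+1 = #|{: option 'I_n}| by rewrite card_option card_ord.
apply: (@proper_colorable _ _
  [ffun x : vertex add_part => if x is inl v then Some (c v) else None]).
apply/proper_coloringP=> e x y E; rewrite !ffunE.
have := ends_neq E; have xE : x \in part_ends e by rewrite [part_ends e]E set21.
have yE : y \in part_ends e by rewrite [part_ends e]E set22.
case: e E xE yE => [e|[u q]] /= E; last first.
  by case: x y {E} => [v|p] [w|r] //; rewrite !inE ?orbF => /eqP-> /eqP->;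
     rewrite eqxx.
case: x y E => [v|p] [w|r] // E; try by rewrite ?(mem_part_ends_inr (inl e)).
move=> _ _ _; apply: (c_proper e); apply/setP=> x.
by move/setP/(_ (inl x)): E; rewrite (mem_part_ends_inl (inl e)) !inE.
Qed.

Lemma proper_sym_coloring_add_part (S : symset) (c : {ffun vertex add_part -> S}) :
  proper_sym_coloring c ->
  proper_sym_coloring [ffun v : vertex G => c (inl v)].
Proof.
move=> /proper_sym_coloringP c_proper; apply/proper_sym_coloringP=> e v w E.
rewrite !ffunE; apply: (c_proper (inl e)).
by rewrite /= E imsetU1 imset_set1.
Qed.

End AddPart.

Definition empty_signed_graph : signed_graph :=
  @SignedGraph (@MGraph void void (fun e => match e with end)
                  (fun e => match e with end))
    (fun e => match e with end).

Definition tower M k : signed_graph := iter k (add_part M) empty_signed_graph.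

Lemma simple_tower M k : simple (tower M k).
Proof. by elim: k => [[]|k] //; apply: simple_add_part. Qed.

Lemma colorable_tower M k : colorable (tower M k) k.
Proof.
elim: k => [|k]; last exact: colorable_add_part.
apply/existsP; exists [ffun v : void => match v with end].
by apply/proper_coloringP=> -[].
Qed.

(** A single [U] must separate the pairs of all values in [A] at once, since a twin of the next part
    sees only one set. As [U] depends on [c], each part provides twins for every set. *)
Lemma tower_twins M k t j (c : {ffun vertex (tower M k) -> std_symset t j}) :
  t + 2 * j < M -> proper_sym_coloring c ->
  exists (A : {set 'I_t + 'I_j}) (U : {set vertex (tower M k)}), #|A| = k /\
    forall a, a \in A -> exists u u',
      [/\ u \in U, u' \notin U, c u = c u' & abs_color (c u) = a].
Proof.
move=> ltM; elim: k c => [|k IHk] c c_proper.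
  by exists set0, set0; rewrite cards0; split=> // a; rewrite inE.
have [A [U [cardA AU]]] := IHk _ (proper_sym_coloring_add_part c_proper).
have /proper_sym_coloringP {}c_proper := c_proper.
pose twin m : vertex (tower M k.+1) := inr (U, m).
have /injectivePn[m [m' neq_mm' Ec]] : ~~ injectiveb (fun m => c (twin m)).
  apply/injectiveP=> /leq_card.
  by rewrite card_std_symset card_ord leqNgt ltM.
have new : abs_color (c (twin m)) \notin A.
  apply/negP=> /AU[u [u' []]]; rewrite !ffunE => uU u'U Eu.
  case/abs_color_eq=> b Eb.
  (* The twin is joined negatively to [u] and positively to [u'], so the edge of sign [b] is
     violated. *)
  have := c_proper (inr (if b then u else u', (U, m))) _ _ erefl.
  by case: b Eb => /= Eb; rewrite ?uU ?(negbTE u'U) -?Eu Eb eqxx.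
(* Only one of the two equally colored twins enters the new set, which therefore separates them. *)
exists (abs_color (c (twin m)) |: A), (twin m |: inl @: U).
split=> [|a]; first by rewrite cardsU1 new cardA.
case/setU1P=> [->|/AU[u [u' []]]].
  exists (twin m), (twin m'); rewrite setU11; split=> //.
  apply/setU1P=> -[[Em]|/imsetP[] //].
  by rewrite Em eqxx in neq_mm'.
rewrite !ffunE => uU u'U Eu Ea; exists (inl u), (inl u'); split=> //.
  by rewrite !inE imset_f.
by rewrite !inE /= mem_imset // => x y [].
Qed.

Lemma sym_colorable_tower M k t j :
  t + 2 * j < M -> sym_colorable (tower M k) t j -> k <= t + j.
Proof.
move=> ltM /existsP[c c_proper].
have [A [_ [cardA _]]] := tower_twins ltM c_proper.
by rewrite -cardA -card_abs_color max_card.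
Qed.

Lemma chromatic_number_tower M k : k < M -> chromatic_number (tower M k) = k.
Proof.
move=> ltM; apply/eqP; rewrite eqn_leq chromatic_number_le ?colorable_tower //=.
have := chromatic_number_colorable (tower M k).
have := chromatic_number_le (colorable_tower M k).
(* An ordinary [n]-coloring gives one with [n] self-inverse colors only, so the tower bound applies
   with [t = n] and [j = 0]; [n <= k] keeps the number of colors below [M]. *)
move: (chromatic_number _) => n le_nk n_col; rewrite -[n]addn0.
apply: (@sym_colorable_tower M); first by lia.
by apply: colorable_sym_colorable; rewrite addn0.
Qed.

Lemma chi_sym_upper (G : signed_graph) k t :
  t <= k -> colorable G k -> chi_sym t G <= 2 * k - t.
Proof.
move=> le_tk k_col; have -> : 2 * k - t = t + 2 * (k - t) by lia.
by apply/chi_sym_le/colorable_sym_colorable; rewrite subnKC.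
Qed.

Theorem theorem2p2 (G : mgraph) (k : nat) (hk : chromatic_number G = k)
    (t : nat) (ht : t <= k) :
  [/\ forall sigma : signature G, chi_sym t (SignedGraph sigma) <= 2 * k - t,
      chi_sym t (signed_extension G) = 2 * k - t
    & exists H : signed_graph,
        [/\ simple H, chromatic_number H = k & chi_sym t H = 2 * k - t]].
Proof.
have G_col : colorable G k by rewrite -hk chromatic_number_colorable.
split=> [sigma||]; first exact: chi_sym_upper.
  apply/eqP; rewrite eqn_leq chi_sym_upper //=; last first.
    have /existsP[c /proper_coloringP c_proper] := G_col.
    apply/existsP; exists c; apply/proper_coloringP=> e v w.
    exact: (c_proper e.1).
  apply: chi_sym_ge => j /sym_colorable_extension/chromatic_number_le.
  by rewrite hk; lia.
(* With [2 * k + 1] twins per set, the tower bound covers all colorings with at most [2 * k] colors;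
   with more colors the lower bound is trivial. *)
exists (tower (2 * k).+1 k); split; first exact: simple_tower.
  by apply: chromatic_number_tower; lia.
apply/eqP; rewrite eqn_leq chi_sym_upper ?colorable_tower //=.
apply: chi_sym_ge => j /sym_colorable_tower le_k.
have [lt_tj|] := ltnP (t + 2 * j) (2 * k).+1; last by lia.
by have := le_k lt_tj; lia.
Qed.
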